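(* Let $g \geq h \geq 2$ be integers. There is a constant $C = C(g,h)$, depending only on $g$ and $h$, such that for every infinite $C_h[g]$-sequence $A \subset \mathbb{N}$, $$\liminf_{n \to \infty} \frac{A(n)(\log n)^{1/h}}{n^{1 - 1/h}} \leq C.$$
   Context: Let $\Gamma$ be an abelian group and $g \geq h \geq 2$ integers. A set $A \subset \Gamma$ is a $C_h[g]$-set if, for any set $X \subset \Gamma$ with $|X| = h$ and any set $\{k_1,\dots,k_g\} \subset \Gamma$ of $g$ distinct elements, at least one of the translates $X + k_i := \{x + k_i : x \in X\}$ is not contained in $A$. An infinite $C_h[g]$-sequence is an infinite set $A \subset \mathbb{N}$ of positive integers that is a $C_h[g]$-set in $\Gamma = \mathbb{Z}$. Its counting function is $A(n) = |A \cap \{1,2,\dots,n\}|$. *)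

(* Defs.v *)
From mathcomp Require Import all_boot all_order all_algebra.
From mathcomp Require Import finmap.
From mathcomp Require Import all_classical all_reals all_analysis.

Set Implicit Arguments.
Unset Strict Implicit.
Unset Printing Implicit Defensive.

Import Order.TTheory GRing.Theory Num.Theory.

Local Open Scope classical_set_scope.
Local Open Scope ring_scope.

Definition translate (G : zmodType) (X : set G) (k : G) : set G :=
  [set x + k | x in X].

Definition is_Chg_set (G : zmodType) (h g : nat) (A : set G) : Prop :=
  forall X K : {fset G}, #|` X|%fset = h -> #|` K|%fset = g ->
    exists2 k, k \in K & ~ (translate [set` X] k `<=` A).

(* The set A of positive integers is a [set nat]; its image in int is needed
   because the X and k of the C_h[g] condition range over all of Z. *)
Definition infinite_Chg_sequence (h g : nat) (A : set nat) : Prop :=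
  [/\ infinite_set A,
      forall a, A a -> (0 < a)%N &
      is_Chg_set h g [set a%:Z | a in A]].

Definition counting_function (A : set nat) (n : nat) : nat :=
  #|` fset_set (A `&` [set a | (1 <= a <= n)%N])|%fset.

(* Main.v *)
Require Import Defs.
From mathcomp Require Import all_boot all_order all_algebra.
From mathcomp Require Import finmap.
From mathcomp Require Import all_classical all_reals all_analysis.
From mathcomp Require Import zify ring lra.

(** Following Erdős's argument for Sidon sets, put q = 2^h and N = q^k, and let
  D_l count the elements of A in the l-th interval of length N. An h-tuple of
  distinct elements of one interval is determined up to translation by h - 1
  differences of absolute value less than N, and each pattern of differences
  occurs fewer than g times, so the sum of D_l^h over l < N is O(N^(h-1)).
  Instead of Hölder's inequality with weights l^(-(1-1/h)), the lower bound on
  sum_l D_l is read off at the points q^j N only, j <= k, and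
  D b^(h-1) <= D^h + b^h is applied with b = lam / 2^j for
  q^(j-1) <= l < q^j. The choice lam^h = N^(h-1) / (k+1) makes the sum of the
  k + 1 terms b^h balance the sum of the D_l^h. *)

Set Implicit Arguments.
Unset Strict Implicit.
Unset Printing Implicit Defensive.

Import Order.TTheory GRing.Theory Num.Theory.

Local Open Scope classical_set_scope.
Local Open Scope ring_scope.

(** * Tuples of elements of [A] inside one block *)

Lemma leq_card_fibers (T S : finType) (phi : T -> S) (P : pred T) (g : nat) :
  (forall s, #|[set x | P x & phi x == s]%SET| <= g)%N ->
  (#|[set x | P x]%SET| <= g * #|S|)%N.
Proof.
move=> fib; rewrite -sum1_card.
rewrite (partition_big phi predT) //= mulnC -sum_nat_const.
apply: leq_sum => s _; apply: leq_trans (fib s).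
rewrite -sum1_card; apply: eq_leq; apply: eq_bigl => x.
by rewrite !inE.
Qed.

(** The summand 1 covers [D < h], where the falling factorial vanishes. Otherwise each of its [h]
    factors is at least [D - h + 1], and [D <= h * (D - h + 1)] when [h] is positive. *)
Lemma expn_leq_ffact (D h : nat) :
  (D ^ h <= h ^ h * (1 + D ^_ h))%N.
Proof.
have [Dh|hD] := ltnP D h.
  by rewrite (@leq_trans (h ^ h)) ?leq_pmulr // leq_exp2r ?(leq_ltn_trans _ Dh) // ltnW.
have fl m : (m <= h)%N -> ((D - h).+1 ^ m <= D ^_ m)%N.
  elim: m => [|m IH] mh //; rewrite expnSr ffactnSr leq_mul ?IH //; lia.
apply: (@leq_trans (h ^ h * (D - h).+1 ^ h)); last first.
  by rewrite leq_mul2l (leq_trans (fl h _)) ?orbT // leq_addl.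
case: h hD {fl} => // h hD.
rewrite -expnMn leq_exp2r //; nia.
Qed.

(** The falling factorials count the injective [h.+1]-tuples in each block, so the left side counts
    pairs of a block and a tuple, and the right side bounds these by fibers over the difference
    patterns. *)
Lemma sum_block_ffact (A : set nat) (g h N L : nat) : (0 < g)%N ->
  is_Chg_set h.+1 g [set a%:Z | a in A] ->
  (\sum_(l < L) #|[set i : 'I_N | `[< A (l * N + i).+1 >]]%SET| ^_ h.+1
    <= g * (2 * N) ^ h)%N.
Proof.
move=> g0 HA.
pose T := ('I_L * {ffun 'I_h.+1 -> 'I_N})%type.
pose P (p : T) := injectiveb p.2 && [forall i, `[< A (p.1 * N + p.2 i).+1 >]].
(* Differences from the first entry are shifted by [N] to stay in the naturals, whence the range
   [2 * N]. *)
have lt_diff (i j : 'I_N) : (i + (N - j) < 2 * N)%N.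
  by have := ltn_ord i; lia.
pose phi (p : T) : {ffun 'I_h -> 'I_(2 * N)} :=
  [ffun i => Ordinal (lt_diff (p.2 (lift ord0 i)) (p.2 ord0))].
have phiE (p r : T) : phi p = phi r -> forall i,
    (p.2 i + r.2 ord0 = r.2 i + p.2 ord0)%N.
  move=> e i; case: (unliftP ord0 i) => [j ->|->]; last by lia.
  have /ffunP/(_ j) := e; rewrite !ffunE => /(congr1 val) /=.
  by have := ltn_ord (p.2 ord0); have := ltn_ord (r.2 ord0); lia.
have -> : (\sum_(l < L) #|[set i : 'I_N | `[< A (l * N + i).+1 >]]%SET| ^_ h.+1)%N
    = #|[set p | P p]%SET|.
  rewrite -sum1_card.
  rewrite (eq_bigl P); last by move=> p; rewrite inE.
  rewrite -(pair_big_dep xpredT (fun l f => P (l, f)) (fun _ _ => 1%N)) /=.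
  apply: eq_bigr => l _.
  have := card_inj_ffuns_on 'I_h.+1
    (mem [set i : 'I_N | `[< A (l * N + i).+1 >]]%SET).
  rewrite card_ord => <-.
  rewrite -sum1_card; apply: eq_bigl => f; rewrite inE /P /= andbC.
  congr (_ && _); apply/ffun_onP/forallP => H i.
    by have : f i \in [set i : 'I_N | `[< A (l * N + i).+1 >]]%SET := H i; rewrite finset.in_set.
  suff : f i \in [set i : 'I_N | `[< A (l * N + i).+1 >]]%SET by [].
  by rewrite finset.in_set.
have -> : ((2 * N) ^ h)%N = #|{ffun 'I_h -> 'I_(2 * N)}|.
  by rewrite card_ffun !card_ord.
apply: (@leq_card_fibers _ _ phi) => s; rewrite leqNgt; apply/negP => gB.
set B := [set _ | _ & _]%SET in gB.
(* Within a fiber the pattern is fixed, so the absolute position of the first entry determines both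
   the block and the tuple. *)
pose pos (p : T) := (p.1 * N + p.2 ord0)%N.
have pos_inj : {in B &, injective pos}.
  move=> [l f] [l' f']; rewrite !inE => /andP[_ /eqP e] /andP[_ /eqP e'].
  rewrite /pos /= => E; have := phiE _ _ (etrans e (esym e')) => /= ff.
  have f0 := ltn_ord (f ord0); have f0' := ltn_ord (f' ord0).
  have N0 : (0 < N)%N by lia.
  have ll : l = l'.
    apply: val_inj => /=; have := congr1 (divn^~ N) E.
    by rewrite !divnMDl // !divn_small // !addn0.
  rewrite -ll in E *; congr pair; apply/ffunP => i; apply: val_inj => /=.
  by have := ff i; lia.
have /card_gt0P[p0 p0B] : (0 < #|B|)%N by exact: leq_ltn_trans gB.
(* [X] is the common pattern based at 0 and [K] holds [g] first entries. Each translate of [X] by an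
   element of [K] is a tuple of the fiber, hence lies in [A]. The successor appears because block
   [l] starts at [l * N + 1]. *)
pose X := [fset x in [seq (p0.2 i)%:Z - (p0.2 ord0)%:Z | i <- enum 'I_h.+1]]%fset.
pose K := [fset x in [seq (pos p).+1%:Z | p <- take g (enum B)]]%fset.
have p0inj : injective p0.2.
  by move: p0B; rewrite !inE => /andP[/andP[/injectiveP]].
have cX : #|` X|%fset = h.+1.
  rewrite card_fseq undup_id; last first.
    rewrite map_inj_uniq ?enum_uniq // => i j /addIr [] /val_inj.
    exact: p0inj.
  by rewrite size_map -cardE card_ord.
have cK : #|` K|%fset = g.
  rewrite card_fseq undup_id; last first.
    rewrite map_inj_in_uniq ?take_uniq ?enum_uniq // => p r pB rB [].
    by apply: pos_inj; rewrite -mem_enum; [exact: mem_take pB|exact: mem_take rB].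
  by rewrite size_map size_take -cardE gB.
have [k] := HA X K cX cK.
rewrite !inE => /mapP[p pB ->]; apply => _ [x + <-].
rewrite /= !inE => /mapP[i _ ->].
have {}pB : p \in B by rewrite -mem_enum; exact: mem_take pB.
move: p0B pB; rewrite !inE => /andP[_ /eqP e0] /andP[/andP[_ /forallP Ap] /eqP e].
exists ((p.1 * N + p.2 i).+1); first exact/asboolP.
have shift (a b c d n : nat) : (a + d = b + c)%N ->
    (n + a).+1%:Z = b%:Z - d%:Z + (n + c).+1%:Z by lia.
exact/shift/(phiE _ _ (etrans e (esym e0))).
Qed.

(** * The counting function as a sum over blocks *)

Lemma leq_counting_function (A : set nat) (n : nat) :
  (counting_function A n <= \sum_(0 <= i < n) `[< A i.+1 >])%N.
Proof.
pose s := [seq x <- iota 1 n | `[< A x >]].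
have Es x : (A `&` [set a | (1 <= a <= n)%N]) x <-> x \in s.
  rewrite mem_filter mem_iota /= add1n ltnS; split.
    by move=> [Ax ->]; rewrite andbT; apply/asboolP.
  by move=> /andP[/asboolP].
have fs : finite_set (A `&` [set a | (1 <= a <= n)%N]).
  apply: (@sub_finite_set _ _ [set` s]); last exact: finite_seq.
  by move=> x /Es.
have sub : (fset_set (A `&` [set a | (1 <= a <= n)%N]) `<=` [fset x in s])%fset.
  apply/fsubsetP => x; rewrite in_fset_set // => /set_mem /Es xs; rewrite inE; exact: xs.
rewrite /counting_function (leq_trans (fsubset_leq_card sub)) //.
rewrite card_fseq (leq_trans (size_undup _)) // size_filter -sum1_count.
rewrite big_mkcond /= -[X in iota X]addn0 iotaDl big_map /index_iota subn0.
by apply: leq_sum => i _; case: `[< _ >].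
Qed.

Lemma sum_blocks (A : set nat) (N L : nat) :
  (\sum_(0 <= i < L * N) `[< A i.+1 >] =
   \sum_(0 <= l < L) #|[set i : 'I_N | `[< A (l * N + i).+1 >]]%SET|)%N.
Proof.
rewrite big_nat_mul; apply: eq_bigr => l _.
rewrite -sum1_card mulSn addnC -[X in \sum_(X <= _ < _) _]add0n [(l * N + N)%N]addnC.
rewrite big_addn addnK big_mkord [RHS]big_mkcond /=.
by apply: eq_bigr => i _; rewrite inE addnC; case: `[< _ >].
Qed.

(** * The dyadic inequality *)

Lemma mulr_expr_le_add (R : realDomainType) (x b : R) (m : nat) :
  0 <= x -> 0 <= b -> x * b ^+ m <= x ^+ m.+1 + b ^+ m.+1.
Proof.
move=> x0 b0; have [xb|/ltW bx] := lerP x b.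
  by rewrite (@le_trans _ _ (b ^+ m.+1)) ?lerDr ?exprn_ge0 // exprS ler_wpM2r ?exprn_ge0.
rewrite (@le_trans _ _ (x ^+ m.+1)) ?lerDl ?exprn_ge0 // exprS ler_wpM2l //.
by rewrite lerXn2r.
Qed.

(** Since [q ^ j] to the power [m / m.+1] is [2 ^ (j * m)], [x j] is a normalized partial sum. The
    extra [x k] on the left closes the induction: the step adds [2 * x k.+1], and the old part of
    that is at most the [x k] already held. *)
Lemma dyadic_sum_le (R : realFieldType) (D : nat -> R) (m : nat) (lam : R) (k : nat)
    (q := (2 ^ m.+1)%N)
    (x := fun j => (\sum_(0 <= l < q ^ j) D l) / 2 ^+ (j * m)) :
  (0 < m)%N -> (forall l, 0 <= D l) -> 0 <= lam ->
  lam ^+ m * (\sum_(0 <= j < k.+1) x j + x k) <=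
    2 * (\sum_(0 <= l < q ^ k) D l ^+ m.+1 + lam ^+ m.+1 * k.+1%:R).
Proof.
move=> m0 D0 lam0.
elim: k => [|k IH].
  rewrite big_nat1 /x expn0 mul0n expr0 divr1 !big_nat1 mulr1.
  have := mulr_expr_le_add m (D0 0%N) lam0; lra.
have qk : (q ^ k <= q ^ k.+1)%N by rewrite leq_exp2l // /q (ltn_exp2l 0).
pose B := \sum_(q ^ k <= l < q ^ k.+1) D l.
have S0 : 0 <= \sum_(0 <= l < q ^ k) D l by rewrite sumr_ge0.
have xS : 2 * x k.+1 <= x k + 2 * (B / 2 ^+ (k.+1 * m)).
  rewrite /x (big_cat_nat (leq0n (q ^ k)) qk) //= -/B [X in 2 * X]mulrDl mulrDr lerD2r.
  rewrite mulSn exprD invfM [X in 2 * X]mulrCA !mulrA.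
  (* The old partial sum loses a factor [2 ^+ m], which is at least 2 because [m] is positive. *)
  rewrite ler_wpM2r ?invr_ge0 ?exprn_ge0 // ler_piMl //.
  rewrite ler_pdivrMr ?exprn_gt0 // mul1r.
  by rewrite -[leLHS]expr1 ler_eXn2l // ltr1n.
have blk : lam ^+ m * (B / 2 ^+ (k.+1 * m)) <=
    \sum_(q ^ k <= l < q ^ k.+1) D l ^+ m.+1 + lam ^+ m.+1.
  pose b := lam / 2 ^+ k.+1.
  have b0 : 0 <= b by rewrite divr_ge0 // exprn_ge0.
  have -> : lam ^+ m * (B / 2 ^+ (k.+1 * m)) =
      \sum_(q ^ k <= l < q ^ k.+1) D l * b ^+ m.
    by rewrite -mulr_suml -/B /b expr_div_n -exprM mulrCA.
  (* The scale [b] is chosen so that [q ^ k.+1] copies of its power give the same total at every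
     level. *)
  have -> : lam ^+ m.+1 = (q ^ k.+1)%:R * b ^+ m.+1.
    rewrite /b expr_div_n -exprM /q -expnM natrX [(k.+1 * _)%N]mulnC mulrCA divff ?mulr1 //.
  apply: (@le_trans _ _ (\sum_(q ^ k <= l < q ^ k.+1) (D l ^+ m.+1 + b ^+ m.+1))).
    by apply: ler_sum => l _; exact: mulr_expr_le_add.
  rewrite big_split /= lerD2l sumr_const_nat -[in leLHS]mulr_natl.
  by rewrite ler_wpM2r ?exprn_ge0 // ler_nat leq_subr.
rewrite big_nat_recr //= [in leRHS](big_cat_nat (leq0n (q ^ k)) qk) //=.
have lm0 : 0 <= lam ^+ m by rewrite exprn_ge0.
have := ler_wpM2l lm0 xS.
rewrite -[k.+2]addn1 natrD.
move: IH blk; set s := \sum_(0 <= j < k.+1) x j.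
set t := B / _; set u := lam ^+ m; set v := lam ^+ m.+1.
rewrite !mulrDr mulrCA [u * (2 * t)]mulrCA. lra.
Qed.

(** * Comparison along powers of [2 ^ m.+1] *)

(** As [n] is a power of [2 ^ m.+1], the fractional power is exact. For the logarithm, [ln 2 <= 1]
    is enough, and a root of [2 * m.+1], being at least 1, is at most the number itself. *)
Lemma powR_log_bounds (R : realType) (m e k : nat) (n : R := ((2 ^ m.+1) ^ e)%N%:R) :
  (e <= 2 * k.+1)%N ->
  n `^ (1 - 1 / m.+1%:R) = 2 ^+ (e * m) /\
  ln n `^ (1 / m.+1%:R) <= 2 * m.+1%:R * k.+1%:R `^ (1 / m.+1%:R).
Proof.
move=> ek; have n0 : m.+1%:R != 0 :> R by rewrite pnatr_eq0.
have nE : n = 2 ^+ (m.+1 * e) by rewrite /n -expnM natrX.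
split.
  rewrite nE -powR_mulrn // -powRrM -[RHS]powR_mulrn //; congr (_ `^ _).
  by rewrite !natrM -[m.+1%:R]natr1; field; rewrite natr1.
have h1 : (1 : R) <= 2 * m.+1%:R by rewrite -natrM ler1n.
apply: (@le_trans _ _ ((2 * m.+1%:R * k.+1%:R) `^ (1 / m.+1%:R))).
  apply: ge0_ler_powR; rewrite ?nnegrE ?divr_ge0 ?mulr_ge0 //.
    by rewrite nE ln_ge0 // exprn_ege1 // ler1n.
  rewrite nE lnXn // -[leLHS]mulr_natl natrM [2 * _]mulrC -!mulrA ler_wpM2l //.
  apply: (@le_trans _ _ e%:R).
    by rewrite ler_piMr // -[2]natr1 addrC le_ln1Dx //; lra.
  by rewrite -natrM ler_nat.
rewrite powRM ?mulr_ge0 // ler_wpM2r ?powR_ge0 //.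
rewrite -[leRHS]powRr1; last by lra.
by apply: ler_powR => //; rewrite ler_pdivrMr ?ltr0n // mul1r ler1n.
Qed.

Lemma sum_block_expn_le (A : set nat) (m g k : nat) (N := ((2 ^ m.+1) ^ k)%N) :
  (0 < m)%N -> (0 < g)%N ->
  is_Chg_set m.+1 g [set a%:Z | a in A] ->
  (\sum_(0 <= l < N) #|[set i : 'I_N | `[< A (l * N + i).+1 >]]%SET| ^ m.+1
    <= m.+1 ^ m.+1 * (1 + g * 2 ^ m) * N ^ m)%N.
Proof.
move=> m0 g0 HA.
rewrite big_mkord; apply: leq_trans (leq_sum _ (fun l _ => expn_leq_ffact _ _)) _.
rewrite -big_distrr -mulnA leq_mul2l /= big_split /=.
rewrite sum_nat_const card_ord muln1 mulnDl mul1n -mulnA -expnMn.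
rewrite leq_add ?orbT ?sum_block_ffact //.
(* The ones from [expn_leq_ffact] add up to [N], which [N ^ m] absorbs since [m] is positive. *)
by rewrite -{1}[N]expn1 leq_pexp2l // !expn_gt0.
Qed.

(** If the ratio exceeded the constant from [n0] on, the dyadic inequality would fail. Of the factor
    [8 * m.+1], [2 * m.+1] pays for the logarithm; the remaining 4 beats the 2 of
    [dyadic_sum_le]. *)
Lemma exists_ratio_le (R : realType) (g m : nat) (A : set nat) (n0 : nat) :
  (0 < m)%N -> (0 < g)%N -> is_Chg_set m.+1 g [set a%:Z | a in A] ->
  exists2 n, (n0 <= n)%N &
   (counting_function A n)%:R * ln (n%:R : R) `^ (1 / m.+1%:R)
     / n%:R `^ (1 - 1 / m.+1%:R)
   <= 8 * m.+1%:R * ((m.+1 ^ m.+1 * (1 + g * 2 ^ m))%:R + 1).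
Proof.
move=> m0 g0 HA; apply: contrapT => noex.
set K := ((_ * _)%N%:R : R) in noex; set C := (_ * (K + 1)) in noex.
have K0 : 0 <= K by [].
have big n : (n0 <= n)%N -> C < (counting_function A n)%:R *
    ln (n%:R : R) `^ (1 / m.+1%:R) / n%:R `^ (1 - 1 / m.+1%:R).
  by move=> nn; rewrite ltNge; apply/negP => le; apply: noex; exists n.
(* With this [k], every sampled point [q ^ (j + k)] is at least [n0]. *)
pose k := n0; pose N := ((2 ^ m.+1) ^ k)%N.
pose D l : R := #|[set i : 'I_N | `[< A (l * N + i).+1 >]]%SET|%:R.
pose r : R := k.+1%:R `^ (1 / m.+1%:R).
pose P : R := 2 ^+ (k * m).
have r0 : 0 < r by rewrite powR_gt0.
have P0 : 0 < P by rewrite exprn_gt0.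
have rm : r ^+ m.+1 = k.+1%:R.
  by rewrite -powR_mulrn ?powR_ge0 // -powRrM mul1r mulVf ?powRr1 ?pnatr_eq0.
(* [P] is [N] to the power [1 - 1/h], with [h = m.+1]. *)
have PN : P ^+ m.+1 = N%:R ^+ m.
  by rewrite /P /N -exprM -natrX -!natrX -!expnM; congr (_ ^ _)%:R; lia.
pose lam := P / r.
have lam0 : 0 <= lam by rewrite divr_ge0 // ltW.
have D0 l : 0 <= D l by rewrite ler0n.
pose x j : R := (\sum_(0 <= l < (2 ^ m.+1) ^ j) D l) / 2 ^+ (j * m).
have : lam ^+ m * (\sum_(0 <= j < k.+1) x j + x k) <=
    2 * (\sum_(0 <= l < N) D l ^+ m.+1 + lam ^+ m.+1 * k.+1%:R).
  exact: dyadic_sum_le.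
have sumD : \sum_(0 <= l < N) D l ^+ m.+1 <= K * P ^+ m.+1.
  rewrite PN -natrX -natrM.
  apply: le_trans (_ : (\sum_(0 <= l < N)
     #|[set i : 'I_N | `[< A (l * N + i).+1 >]]%SET| ^ m.+1)%:R <= _).
    by rewrite natr_sum; apply: ler_sum => l _; rewrite natrX.
  by rewrite ler_nat sum_block_expn_le.
have xlow j : (j <= k)%N -> C * P / (2 * m.+1%:R * r) <= x j.
  move=> jk; set n := ((2 ^ m.+1) ^ (j + k))%N.
  have nn : (n0 <= n)%N.
    rewrite /n -expnM (leq_trans (ltnW (ltn_expl n0 (ltnSn 1)))) //.
    rewrite leq_exp2l // /k; nia.
  have jk2 : (j + k <= 2 * k.+1)%N by lia.
  have [nE lnle] := powR_log_bounds R m jk2.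
  have := big _ nn; rewrite nE -/r in lnle *.
  rewrite ltr_pdivlMr ?exprn_gt0 // => lb.
  have cnt : (counting_function A n)%:R <= \sum_(0 <= l < (2 ^ m.+1) ^ j) D l.
    rewrite -natr_sum ler_nat (leq_trans (leq_counting_function _ _)) //.
    by rewrite /n expnD sum_blocks.
  rewrite ler_pdivrMr ?mulr_gt0 ?ltr0n // /x [leRHS]mulrAC ler_pdivlMr ?exprn_gt0 //.
  rewrite -[leLHS]mulrA /P -exprD -mulnDl [(k + j)%N]addnC.
  apply: (le_trans (ltW lb)).
  apply: (le_trans (ler_wpM2l _ lnle)) => //.
  by rewrite ler_wpM2r // !mulr_ge0 // ltW.
have sumx : C * P / (2 * m.+1%:R * r) * k.+1%:R <= \sum_(0 <= j < k.+1) x j.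
  rewrite mulr_natr -[X in _ *+ X]subn0 -sumr_const_nat.
  by rewrite big_nat [leRHS]big_nat; apply: ler_sum => j; rewrite ltnS; exact: xlow.
have x0 : 0 <= x k by rewrite divr_ge0 ?exprn_ge0 ?sumr_ge0.
have lamE : lam ^+ m.+1 * k.+1%:R = P ^+ m.+1.
  by rewrite /lam expr_div_n rm divfK // pnatr_eq0.
rewrite lamE => main.
have lm0 : 0 <= lam ^+ m by rewrite exprn_ge0.
have E : lam ^+ m * (C * P / (2 * m.+1%:R * r) * k.+1%:R) = 4 * (K + 1) * P ^+ m.+1.
  rewrite -rm /C /lam expr_div_n !exprS; field.
  by rewrite !lt0r_neq0 ?exprn_gt0 // nat1r.
have := ler_wpM2l lm0 sumx; rewrite E.
have Pm : 0 < P ^+ m.+1 by rewrite exprn_gt0.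
have xx := mulr_ge0 lm0 x0.
move: main; rewrite [lam ^+ m * (_ + _)]mulrDr.
set s := lam ^+ m * _; set y := lam ^+ m * x k in xx *.
(* The bounds combine to [4 * (K + 1) * P ^+ m.+1 <= 2 * (K + 1) * P ^+ m.+1], impossible as [P] is
   positive. *)
nra.
Qed.

Theorem theorem5 (R : realType) (g h : nat) (hh : (2 <= h)%N) (hg : (h <= g)%N) :
  exists C : R, forall A : set nat, infinite_Chg_sequence h g A ->
    (limn_einf (fun n : nat =>
       ((counting_function A n)%:R * ln (n%:R : R) `^ (1 / h%:R)
          / n%:R `^ (1 - 1 / h%:R))%:E) <= C%:E)%E.
Proof.
case: h hh hg => // m m0 mg.
(* The constant is left open before [A] is introduced, so it cannot depend on [A]; [exists_ratio_le]
   supplies it. *)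
eexists => A [_ _ HA]; rewrite limn_einf_lim.
apply: lime_le; first exact: is_cvg_einfs.
(* The lower limit is the limit of the infima over tails, so one good [n] beyond each [n0]
   suffices. *)
apply: nearW => n0.
have [n nn le] := exists_ratio_le R n0 m0 (leq_trans (ltn0Sn m) mg) HA.
move: le; rewrite -lee_fin; apply: le_trans.
by apply: ereal_inf_lbound; exists n.
Qed.
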